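(* Let $\Sigma=\{0,1,+,-,\cdot,{}^{-1}\}$ (with $0,1$ constants, $-$ and ${}^{-1}$ unary, $+$ and $\cdot$ binary), and let $M$ be a finite $\Sigma$-structure with cardinality $n$. Then $M$ is a meadow if and only if there are (not necessarily distinct) primes $p_1,\ldots,p_k$ and positive integers $n_1,\ldots,n_k$ ($k\ge 0$) such that $$M\cong GF(p_1^{n_1})\times\cdots\times GF(p_k^{n_k})$$ (isomorphism of $\Sigma$-structures, with operations on the product defined componentwise) and $n=p_1^{n_1}\cdots p_k^{n_k}$.
   Context: A meadow is a commutative ring with identity element $1$ (it is not required that $0\neq 1$) equipped with a total unary operation ${}^{-1}$ satisfying, for all $x$, $(x^{-1})^{-1}=x$ and $x\cdot(x\cdot x^{-1})=x$. For a prime $p$ and integer $m\ge 1$, $GF(p^m)$ denotes the finite field with $p^m$ elements, viewed as a $\Sigma$-structure in which ${}^{-1}$ is the total operation given by the usual multiplicative inverse on nonzero elements and $0^{-1}=0$. The empty product ($k=0$) is the one-element structure. *)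

(* Defs.v *)
From HB Require Import structures.
From mathcomp Require Import all_boot all_order all_fingroup all_algebra.
From mathcomp Require Import all_solvable all_field.
Set Implicit Arguments.
Unset Strict Implicit.
Unset Printing Implicit Defensive.
Import GRing.Theory.
Local Open Scope ring_scope.

Record sigma_struct (T : Type) : Type := SigmaStruct {
  szero : T;
  sone : T;
  sadd : T -> T -> T;
  sopp : T -> T;
  smul : T -> T -> T;
  sinv : T -> T }.

(* Neither 0 != 1 nor 0^-1 = 0 is an axiom; the latter is derivable. *)
Record is_meadow (T : Type) (S : sigma_struct T) : Prop := IsMeadow {
  meadow_addA : associative (sadd S);
  meadow_addC : commutative (sadd S);
  meadow_add0 : left_id (szero S) (sadd S);
  meadow_addN : left_inverse (szero S) (sopp S) (sadd S);
  meadow_mulA : associative (smul S);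
  meadow_mulC : commutative (smul S);
  meadow_mul1 : left_id (sone S) (smul S);
  meadow_mulD : left_distributive (smul S) (sadd S);
  meadow_invK : involutive (sinv S);
  meadow_ril : forall x, smul S x (smul S x (sinv S x)) = x }.

Definition sigma_iso (T U : Type) (S : sigma_struct T) (S' : sigma_struct U) :
    Prop :=
  exists f : T -> U,
    bijective f /\
    f (szero S) = szero S' /\
    f (sone S) = sone S' /\
    {morph f : x y / sadd S x y >-> sadd S' x y} /\
    {morph f : x / sopp S x >-> sopp S' x} /\
    {morph f : x y / smul S x y >-> smul S' x y} /\
    {morph f : x / sinv S x >-> sinv S' x}.

(* The inverse of a fieldType is total, with 0^-1 = 0 (invr0). *)
Definition field_sigma (F : fieldType) : sigma_struct F :=
  SigmaStruct 0 1 +%R -%R *%R GRing.inv.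

Definition prod_sigma (I : finType) (T : I -> Type)
    (S : forall i, sigma_struct (T i)) : sigma_struct {ffun forall i, T i} :=
  SigmaStruct
    [ffun i => szero (S i)]
    [ffun i => sone (S i)]
    (fun x y => [ffun i => sadd (S i) (x i) (y i)])
    (fun x => [ffun i => sopp (S i) (x i)])
    (fun x y => [ffun i => smul (S i) (x i) (y i)])
    (fun x => [ffun i => sinv (S i) (x i)]).

(* pPrimePowerField is opaque; card_GF
   determines the field up to isomorphism. *)
Definition GF (p m : nat) (p_pr : prime p) (m_gt0 : (0 < m)%N) : finFieldType :=
  s2val (pPrimePowerField p_pr m_gt0).

Lemma card_GF (p m : nat) (p_pr : prime p) (m_gt0 : (0 < m)%N) :
  #|GF p_pr m_gt0| = (p ^ m)%N.
Proof. exact: s2valP' (pPrimePowerField p_pr m_gt0). Qed.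

(* Main.v *)
Require Import Defs.
From HB Require Import structures.
From mathcomp Require Import all_boot all_order all_fingroup all_algebra.
From mathcomp Require Import all_solvable all_field.
Set Implicit Arguments.
Unset Strict Implicit.
Unset Printing Implicit Defensive.
Import GRing.Theory.

(** A product of fields is a meadow, since the meadow axioms are identities
    that hold in every field with 0^-1 = 0, and identities pass to products
    and through isomorphisms.

    Conversely, the law x * (x * x^-1) = x makes a meadow a commutative von
    Neumann regular ring, in which every element x generates the same ideal
    as the idempotent x * x^-1. When the ring is finite, its idempotents form
    a finite Boolean algebra, so the atoms e of that algebra are pairwise
    orthogonal and sum to 1 ([atom_orth], [sum_atoms]). Hence the ring is the
    product of the corners e R. Regularity gives an inverse to each nonzero
    element of e R, because the idempotent it generates lies below the atom e
    and must be e itself ([atom_inverse]); thus each corner is a finite field.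
    A finite field is determined by its cardinality ([finField_iso]), which
    is a prime power, so each corner is some GF(p^m) ([corner_GF]).

    This gives an isomorphism of rings only; it respects the inverse
    operations because in a meadow the element x^-1 is the only y
    with x (x y) = x and y (y x) = y, a condition on the multiplication alone
    ([reflexive_inverse_unique], [morph_sinv]). The empty set of atoms
    corresponds to the ring where 0 = 1. *)

(** * Uniqueness of finite fields *)

Section FiniteFieldUniqueness.
Local Open Scope ring_scope.

(** X^q - X splits over the field with q elements, hence so do its
    divisors. *)
Lemma dvdp_genPoly_root (L : finFieldType) (q : {poly L}) :
  q %| 'X^#|L| - 'X -> size q != 1 -> exists w, root q w.
Proof.
rewrite finField_genPoly => /dvdp_prod_XsubC[m Dq].
rewrite (eqp_size Dq); case Dr: (mask m _) => [|w r].
  by rewrite big_nil size_poly1.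
by exists w; rewrite (eqp_root Dq) Dr big_cons rootM root_XsubC eqxx.
Qed.

Lemma finField_generator (K : finFieldType) :
  exists z : K, forall x, x != 0 -> exists i, x = z ^+ i.
Proof.
have /cyclicP[u Du] := field_unit_group_cyclic [set: {unit K}]%G.
exists (val u) => x x0; have Ux : x \is a GRing.unit by rewrite unitfE.
have /cycleP[i Di] : FinRing.unit K Ux \in <[u]>%g by rewrite -Du inE.
by exists i; rewrite -[x]/(val (FinRing.unit K Ux)) Di FinRing.val_unitX.
Qed.

(** A generator z of K^* generates K over 'F_p, so K is 'F_p[X] modulo the
    minimal polynomial f of z. Since z is a root of X^q - X, f divides that
    polynomial, which also splits over L; thus f has a root w in L and
    g(z) |-> g(w) is a well-defined morphism K -> L. It is injective as K is a
    field, hence bijective by cardinality. *)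
Lemma finField_iso (K L : finFieldType) : #|K| = #|L| ->
  exists f : K -> L,
    [/\ bijective f, f 1 = 1, {morph f : x y / x + y} &
       {morph f : x y / x * y}].
Proof.
move=> eqKL; have [p p_pr chK] := finPcharP K.
have chL : p \in [pchar L].
  apply: card_finPcharP p_pr; rewrite -eqKL; exact: (card_pprimeChar chK).
pose K' := pPrimeCharType chK; pose L' := pPrimeCharType chL.
have [z genz] := finField_generator K.
pose evK (g : {poly 'F_p}) : K' := (map_poly (in_alg K') g).[z].
have [f Df] : exists f : {poly 'F_p},
    minPoly 1 (z : K') = map_poly (in_alg K') f.
  by apply/polyOver1P; apply: minPolyOver.
have annP g : evK g = 0 -> f %| g.
  move=> /eqP gz0; rewrite -(dvdp_map (in_alg K')) -Df minPoly_dvdp //.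
  by apply/polyOver1P; exists g.
have fdvd : f %| 'X^#|K| - 'X.
  apply: annP; rewrite /evK rmorphB /= map_polyXn map_polyX !hornerE.
  by apply/eqP; rewrite subr_eq0; apply/eqP; exact: (expf_card z).
have [w fw0] : exists w : L', root (map_poly (in_alg L') f) w.
  apply: dvdp_genPoly_root; last first.
    by rewrite size_map_poly -(size_map_poly (in_alg K')) -Df size_minPoly.
  have := fdvd; rewrite -(dvdp_map (in_alg L')) rmorphB /= map_polyXn map_polyX.
  by rewrite eqKL.
pose evL (g : {poly 'F_p}) : L' := (map_poly (in_alg L') g).[w].
have evKL g h : evK g = evK h -> evL g = evL h.
  move=> Egh; have /annP : evK (g - h) = 0.
    by rewrite /evK rmorphB hornerD hornerN -/(evK g) Egh subrr.
  rewrite -(dvdp_map (in_alg L')) => /(dvdp_trans _) H.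
  apply/eqP; rewrite -subr_eq0 /evL -hornerN -hornerD -rmorphB.
  have : 'X - w%:P %| map_poly (in_alg L') (g - h) by rewrite H ?dvdp_XsubCl.
  by rewrite dvdp_XsubCl.
have evK_onto x : exists g, evK g == x.
  have [-> | /genz[i ->]] := eqVneq x 0.
    by exists 0; rewrite /evK rmorph0 horner0.
  by exists 'X^i; rewrite /evK map_polyXn hornerXn.
(* phi sends x to g(w) for any g with g(z) = x; the choice is irrelevant by
   evKL. *)
pose phi x := evL (xchoose (evK_onto x)).
have phiE g : phi (evK g) = evL g.
  by apply: evKL; apply/eqP; apply: (xchooseP (evK_onto _)).
have onto x : exists g, x = evK g.
  by have [g /eqP] := evK_onto x; exists g.
have phi1 : phi 1 = 1.
  have -> : 1 = evK 1 by rewrite /evK rmorph1 hornerC.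
  by rewrite phiE /evL rmorph1 hornerC.
have phiD : {morph phi : x y / x + y}.
  move=> x y; have [[g ->] [h ->]] := (onto x, onto y).
  have -> : evK g + evK h = evK (g + h) by rewrite /evK rmorphD hornerD.
  by rewrite !phiE /evL rmorphD hornerD.
have phiM : {morph phi : x y / x * y}.
  move=> x y; have [[g ->] [h ->]] := (onto x, onto y).
  have -> : evK g * evK h = evK (g * h) by rewrite /evK rmorphM hornerM.
  by rewrite !phiE /evL rmorphM hornerM.
exists phi; split => //.
apply: inj_card_bij; last by rewrite eqKL.
move=> x y Exy; apply/eqP; rewrite -subr_eq0; apply/negPn/negP => nz.
have phi0 : phi 0 = 0 by apply: (addrI (phi 0)); rewrite -phiD !addr0.
have /eqP : phi 1 = 0.
  rewrite -(divff nz) phiM; apply/eqP; rewrite mulf_eq0; apply/orP; left.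
  rewrite -(subrr (phi y)) -{1}Exy -[_ == _](inj_eq (addIr (phi y))).
  by rewrite -phiD !subrK.
by rewrite phi1 oner_eq0.
Qed.
End FiniteFieldUniqueness.

(** * Atoms of the Boolean algebra of idempotents *)

Section Regular.
Local Open Scope ring_scope.

Definition von_neumann_regular (R : comPzRingType) :=
  forall x : R, exists y, x * (x * y) = x.

(** An atom for the order on idempotents in which f <= e means e * f = f. *)
Definition atom (R : finComPzRingType) (e : R) :=
  [&& e != 0, e * e == e &
      [forall f, (f * f == f) && (e * f == f) ==> (f == 0) || (f == e)]].

Section Atoms.
Variable R : finComPzRingType.
Implicit Types e f x : R.

Lemma atom_neq0 e : atom e -> e != 0. Proof. by case/and3P. Qed.
Lemma atom_idem e : atom e -> e * e = e. Proof. by case/and3P=> _ /eqP. Qed.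
Lemma atom_min e f : atom e -> f * f = f -> e * f = f -> f != 0 -> f = e.
Proof.
case/and3P=> _ _ /forallP/(_ f) + ff ef /negPf f0.
by rewrite ff ef f0 !eqxx /= => /eqP.
Qed.

(** Among the nonzero idempotents below f, one generating an ideal of least
    cardinality is an atom: a nonzero idempotent g below e generates a
    subideal of that of e, hence the same ideal, and then g = e. *)
Lemma atom_below f : f * f = f -> f != 0 -> exists2 e, atom e & f * e = e.
Proof.
move=> ff f0.
pose P g := [&& g != 0, g * g == g & f * g == g].
have Pf : P f by rewrite /P f0 ff eqxx.
case: (@arg_minnP _ f P (fun g => #|[set x | g * x == x]|) Pf) => e.
case/and3P=> e0 /eqP ee /eqP fe emin; exists e => //.
rewrite /atom e0 ee eqxx; apply/forallP=> g.
apply/implyP=> /andP[/eqP gg /eqP eg].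
have [//|g0] /= := eqVneq g 0.
have Pg : P g by rewrite /P g0 gg -eg mulrA fe !eqxx.
have sub : [set x | g * x == x] \subset [set x | e * x == x].
  by apply/subsetP=> x; rewrite !inE => /eqP <-; rewrite mulrA eg.
have /eqP Eset : [set x | g * x == x] == [set x | e * x == x].
  by rewrite eqEcard sub emin.
have: e \in [set x | g * x == x] by rewrite Eset inE ee.
by rewrite inE => /eqP <-; rewrite mulrC eg.
Qed.

(** A nonzero product e * f would be an idempotent below both atoms, hence
    equal to both. *)
Lemma atom_orth e f : atom e -> atom f -> e != f -> e * f = 0.
Proof.
move=> ae af; apply: contraNeq => ef0.
have ii : (e * f) * (e * f) = e * f by rewrite mulrACA !atom_idem.
rewrite -(atom_min ae ii _ ef0) ?mulrA ?atom_idem //.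
by rewrite {1}(atom_min af ii _ ef0) // mulrCA atom_idem.
Qed.

(** The complement of the sum is an idempotent orthogonal to every atom, so no
    atom lies below it and it vanishes. *)
Lemma sum_atoms : \sum_(e | atom e) e = 1 :> R.
Proof.
pose s : R := 1 - \sum_(e | atom e) e.
have se e : atom e -> s * e = 0.
  move=> ae; rewrite mulrBl mul1r mulr_suml (bigD1 e) //= atom_idem //.
  rewrite big1 ?addr0 ?subrr //.
  by move=> f /andP[af fe]; rewrite atom_orth.
have ss : s * s = s.
  rewrite {2}/s mulrBr mulr1 mulr_sumr big1 ?subr0 // => e; exact: se.
apply/eqP; rewrite eq_sym -subr_eq0 -/s; apply/negPn/negP=> s0.
have [e ae] := atom_below ss s0; rewrite se // => e0.
by have := atom_neq0 ae; rewrite -e0 eqxx.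
Qed.

(** If x (x y) = x, then e x y is a nonzero idempotent below e, hence e. *)
Lemma atom_inverse e x : von_neumann_regular R -> atom e -> e * x != 0 ->
  exists y, x * (e * y) = e.
Proof.
move=> rR ae ex0; have [y Dy] := rR x; exists y.
have gx : x * (e * y) * x = e * x.
  by rewrite mulrAC mulrACA [x * e]mulrC -!mulrA Dy.
apply: atom_min => //.
- have xyI : x * y * (x * y) = x * y by rewrite mulrCA mulrA Dy.
  by rewrite [x * (e * y)]mulrCA mulrACA atom_idem // xyI.
- by rewrite [x * (e * y)]mulrCA [LHS]mulrA atom_idem.
- by apply: contraNneq ex0 => g0; rewrite -gx g0 mul0r.
Qed.
End Atoms.

(** * The corner of an atom is a finite field *)

Section Corner.
Variables (R : finComPzRingType) (regR : von_neumann_regular R).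
Variables (e : R) (ae : atom e).

(** The ideal e R, with e as identity element. The proofs are parameters of
    the type so that the field structure can be attached to it. *)
Definition corner of von_neumann_regular R & atom e : predArgType :=
  {x : R | e * x == x}.
Local Notation C := (corner regR ae).
HB.instance Definition _ := SubFinite.on C.

Fact corner_proj_subproof x : e * (e * x) == e * x.
Proof. by rewrite mulrA atom_idem. Qed.
Definition corner_proj x : C := exist _ (e * x) (corner_proj_subproof x).

Lemma corner_projK (x : C) : corner_proj (val x) = x.
Proof. by apply: val_inj; rewrite /= (eqP (valP x)). Qed.

Lemma val_corner (x : C) : e * val x = val x.
Proof. exact: eqP (valP x). Qed.

Let cadd (x y : C) := corner_proj (val x + val y).
Let copp (x : C) := corner_proj (- val x).
Let cmul (x y : C) := corner_proj (val x * val y).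

Let caddA : associative cadd.
Proof.
by move=> x y z; apply: val_inj; rewrite /= !mulrDr !val_corner addrA.
Qed.
Let caddC : commutative cadd.
Proof. by move=> x y; apply: val_inj; rewrite /= addrC. Qed.
Let cadd0 : left_id (corner_proj 0) cadd.
Proof. by move=> x; apply: val_inj; rewrite /= mulr0 add0r val_corner. Qed.
Let caddN : left_inverse (corner_proj 0) copp cadd.
Proof. by move=> x; apply: val_inj; rewrite /= mulrN val_corner addNr. Qed.
HB.instance Definition _ := GRing.isZmodule.Build C caddA caddC cadd0 caddN.

Let cmulA : associative cmul.
Proof.
by move=> x y z; apply: val_inj; rewrite /= [_ * (e * (_ * _))]mulrCA !mulrA.
Qed.
Let cmulC : commutative cmul.
Proof. by move=> x y; apply: val_inj; rewrite /= [val x * _]mulrC. Qed.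
Let cmul1 : left_id (corner_proj 1) cmul.
Proof. by move=> x; apply: val_inj; rewrite /= mulr1 !val_corner. Qed.
Let cmulD : left_distributive cmul cadd.
Proof.
move=> x y z; apply: val_inj.
by rewrite /= !mulrDr !val_corner mulrDl !mulrDr !mulrA atom_idem.
Qed.
Let cone_neq0 : corner_proj 1 != 0.
Proof. by rewrite -val_eqE /= mulr1 mulr0 atom_neq0. Qed.
HB.instance Definition _ := GRing.Zmodule_isComNzRing.Build C
  cmulA cmulC cmul1 cmulD cone_neq0.

(** The default value serves x = 0, which must be sent to 0. *)
Definition corner_inv (x : C) : C := odflt 0 [pick y : C | y * x == 1].
Let cmulVf (x : C) : x != 0 -> corner_inv x * x = 1.
Proof.
move=> x0; rewrite /corner_inv; case: pickP => [y /eqP // | no].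
have [|y Dy] := atom_inverse (x := val x) regR ae.
  rewrite val_corner; apply: contraNneq x0 => x0.
  by apply/eqP/val_inj; rewrite x0 /= mulr0.
have /negP[] := negbT (no (corner_proj y)); apply/eqP/val_inj.
by rewrite /= mulr1 [_ * val x]mulrC Dy atom_idem.
Qed.
Let cinv0 : corner_inv 0 = 0.
Proof.
rewrite /corner_inv; case: pickP => // y; rewrite mulr0 eq_sym.
by rewrite (negPf cone_neq0).
Qed.
HB.instance Definition _ := GRing.ComNzRing_isField.Build C cmulVf cinv0.

Definition corner_field : finFieldType := C.

Lemma corner_projD : {morph corner_proj : x y / x + y >-> x + y}.
Proof. by move=> x y; apply: val_inj; rewrite /= -mulrDr mulrA atom_idem. Qed.
Lemma corner_projM : {morph corner_proj : x y / x * y >-> x * y}.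
Proof.
move=> x y; apply: val_inj.
by rewrite /= [e * x * _]mulrACA atom_idem // [RHS]mulrA atom_idem.
Qed.

(** The field e R, presented by the projection h of R onto it and the
    inclusion g of it in R, so that the type e R itself does not appear. *)
Lemma corner_GF :
  exists p m (p_pr : prime p) (m_gt0 : (0 < m)%N)
         (h : R -> GF p_pr m_gt0) (g : GF p_pr m_gt0 -> R),
  [/\ {morph h : x y / x + y}, {morph h : x y / x * y}, h 1 = 1,
      forall x, g (h x) = e * x & cancel g h].
Proof.
have [p p_pr chC] := finPcharP corner_field.
pose m := logn p #|corner_field|.
have cardC : #|corner_field| = (p ^ m)%N by exact: (card_pprimeChar chC).
have m_gt0 : (0 < m)%N.
  have := card_finNzRing_gt1 corner_field.
  by rewrite cardC; case: (m).
exists p, m, p_pr, m_gt0.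
have [|f [[f' fK f'K] f1 fD fM]] := @finField_iso corner_field (GF p_pr m_gt0).
  by rewrite cardC card_GF.
exists (fun x => f (corner_proj x)), (fun y => val (f' y)); split.
- by move=> x y; rewrite corner_projD fD.
- by move=> x y; rewrite corner_projM fM.
- exact: f1.
- by move=> x; rewrite fK.
- by move=> y; rewrite corner_projK f'K.
Qed.
End Corner.
End Regular.

(** * Meadows *)

Section Meadow.
Local Open Scope ring_scope.

Section MeadowRing.
Variables (M : finType) (S : sigma_struct M).

(** A copy of M that carries the ring structure given by the axioms. *)
Definition meadow_ring of is_meadow S : predArgType := M.

Variable mS : is_meadow S.
Local Notation R := (meadow_ring mS).

HB.instance Definition _ := Finite.on R.
HB.instance Definition _ := @GRing.isZmodule.Build R (szero S) (sopp S) (sadd S)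
  (meadow_addA mS) (meadow_addC mS) (meadow_add0 mS) (meadow_addN mS).
HB.instance Definition _ := @GRing.Zmodule_isComPzRing.Build R (sone S) (smul S)
  (meadow_mulA mS) (meadow_mulC mS) (meadow_mul1 mS) (meadow_mulD mS).

Lemma meadow_regular : von_neumann_regular R.
Proof. by move=> x; exists (sinv S x); apply: meadow_ril. Qed.

End MeadowRing.

Lemma field_meadow (F : fieldType) : is_meadow (field_sigma F).
Proof.
split; rewrite /=; [exact: addrA | exact: addrC | exact: add0r | exact: addNr |
  exact: mulrA | exact: mulrC | exact: mul1r | exact: mulrDl | exact: invrK | ].
move=> x; have [-> | x0] := eqVneq x 0; first by rewrite mul0r.
by rewrite divff // mulr1.
Qed.

Lemma prod_meadow (I : finType) (T : I -> Type)
    (S : forall i, sigma_struct (T i)) :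
  (forall i, is_meadow (S i)) -> is_meadow (prod_sigma S).
Proof.
move=> mS; split=> [x y z|x y|x|x|x y z|x y|x|x y z|x|x];
  apply/ffunP=> i; rewrite !ffunE; have [? ? ? ? ? ? ? ? ? ?] := mS i; auto.
Qed.

Lemma sigma_iso_meadow (T U : Type) (S : sigma_struct T) (S' : sigma_struct U) :
  sigma_iso S S' -> is_meadow S' -> is_meadow S.
Proof.
case=> f [/bij_inj fI [f0 [f1 [fD [fN [fM fV]]]]]] [? ? ? ? ? ? ? ? ? ?].
by split=> [x y z|x y|x|x|x y z|x y|x|x y z|x|x]; apply: fI;
  rewrite !(f0, f1, fD, fN, fM, fV).
Qed.

(** Any such y and z satisfy y = y x z = z x y, since x = x (x z) gives
    y = y (y x) = y (y x) x z = y x z. *)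
Lemma reflexive_inverse_unique (R : comPzRingType) (x y z : R) :
    x * (x * y) = x -> y * (y * x) = y ->
    x * (x * z) = x -> z * (z * x) = z -> y = z.
Proof.
move=> xxy yyx xxz zzx.
have absorb a b : x * (x * b) = x -> a * (a * x) = a -> a = a * x * b.
  move=> xxb aax; rewrite -[in RHS]aax -[LHS]aax -{1}xxb.
  by rewrite !mulrA.
by rewrite (absorb y z) // [RHS](absorb z y) // [LHS]mulrC mulrA [RHS]mulrAC.
Qed.

(** The image of x^-1 and the inverse of the image of x both satisfy the
    multiplicative condition that determines inverses. *)
Lemma morph_sinv (M : Type) (S : sigma_struct M) (F : fieldType) (h : M -> F) :
    is_meadow S -> {morph h : x y / smul S x y >-> x * y} ->
  {morph h : x / sinv S x >-> x^-1}.
Proof.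
move=> mS hM x; have ril := meadow_ril mS.
have fril := meadow_ril (field_meadow F).
apply: (@reflexive_inverse_unique _ (h x)).
- by rewrite -!hM ril.
- by rewrite -!hM -{3}(meadow_invK mS x) ril.
- exact: fril.
- by rewrite -{3}[h x]invrK; exact: fril.
Qed.

(** The isomorphism sends x to the family of its projections to the corners;
    its inverse sends a family y to the sum of the y i, seen in M. *)
Lemma meadow_prod_GF (M : finType) (S : sigma_struct M) : is_meadow S ->
  exists k (p m : 'I_k -> nat) (p_pr : forall i, prime (p i))
         (m_gt0 : forall i, (0 < m i)%N),
    sigma_iso S (prod_sigma (fun i => field_sigma (GF (p_pr i) (m_gt0 i)))).
Proof.
move=> mS; pose R : finComPzRingType := meadow_ring mS.
pose A := [set e : R | atom e]; pose e (i : 'I_#|A|) : R := enum_val i.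
have ae i : atom (e i) by have := enum_valP i; rewrite inE.
have := fun i => corner_GF (meadow_regular (mS:=mS)) (ae i).
case/fin_all_exists=> p /fin_all_exists[m /fin_all_exists[p_pr]].
case/fin_all_exists=> m_gt0 /fin_all_exists[h /fin_all_exists[g H]].
exists #|A|, p, m, p_pr, m_gt0.
have hD i : {morph h i : x y / x + y} by case: (H i).
have hM i : {morph h i : x y / x * y} by case: (H i).
have h1 i : h i 1 = 1 by case: (H i).
have hK i x : g i (h i x) = e i * x by case: (H i).
have gK i : cancel (g i) (h i) by case: (H i).
have h0 i : h i 0 = 0 by apply: (addrI (h i 0)); rewrite -hD !addr0.
have hN i : {morph h i : x / - x}.
  by move=> x; apply: (addrI (h i x)); rewrite -hD !subrr h0.
have eg i y : e i * g i y = g i y by rewrite -hK gK.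
have sum_e : \sum_i e i = 1.
  rewrite -(sum_atoms R) -(big_enum_val (fun x => x)).
  by apply: eq_bigl => x; rewrite inE.
exists (fun x => [ffun i => h i x]); split; last first.
  split; first by apply/ffunP=> i; rewrite !ffunE; exact: h0.
  split; first by apply/ffunP=> i; rewrite !ffunE; exact: h1.
  split; first by move=> x y; apply/ffunP=> i; rewrite !ffunE; exact: hD.
  split; first by move=> x; apply/ffunP=> i; rewrite !ffunE; exact: hN.
  split; first by move=> x y; apply/ffunP=> i; rewrite !ffunE; exact: hM.
  move=> x; apply/ffunP=> i; rewrite !ffunE /=.
  exact: (morph_sinv mS (hM i)).
exists (fun y : {ffun forall i, GF (p_pr i) (m_gt0 i)} =>
          \sum_i g i (y i)) => [x | y].
  under eq_bigr do rewrite ffunE hK.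
  by rewrite -mulr_suml sum_e mul1r.
apply/ffunP=> i; rewrite ffunE -[RHS]gK.
have he x : h i x = h i (e i * x) by rewrite -hK gK.
rewrite he mulr_sumr (bigD1 i) //= eg big1 ?addr0 // => j ji.
have eij : e i != e j by rewrite (inj_eq enum_val_inj) eq_sym.
by rewrite -eg mulrA (atom_orth (ae i) (ae j) eij) mul0r.
Qed.

Lemma card_sigma_iso_prod_GF (M : finType) (S : sigma_struct M) k
    (p m : 'I_k -> nat) (p_pr : forall i, prime (p i))
    (m_gt0 : forall i, (0 < m i)%N) :
  sigma_iso S (prod_sigma (fun i => field_sigma (GF (p_pr i) (m_gt0 i)))) ->
  #|M| = (\prod_(i < k) p i ^ m i)%N.
Proof.
case=> f [f_bij _].
rewrite (@bij_eq_card _ {dffun forall i : 'I_k, GF (p_pr i) (m_gt0 i)} f f_bij).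
rewrite card_dep_ffun foldrE big_map big_enum /=.
by apply: eq_bigr => i _; rewrite card_GF.
Qed.
End Meadow.

Theorem corollary2p8 (M : finType) (S : sigma_struct M) (n : nat)
    (card_M : #|M| = n) :
  is_meadow S <->
  exists (k : nat) (p m : 'I_k -> nat)
         (p_pr : forall i, prime (p i)) (m_gt0 : forall i, 0 < m i),
    sigma_iso S (prod_sigma (fun i => field_sigma (GF (p_pr i) (m_gt0 i)))) /\
    n = \prod_(i < k) p i ^ m i.
Proof.
split=> [mS | [k [p [m [p_pr [m_gt0 [isoS _]]]]]]].
  have [k [p [m [p_pr [m_gt0 isoS]]]]] := meadow_prod_GF mS.
  exists k, p, m, p_pr, m_gt0; split=> //.
  by rewrite -card_M (card_sigma_iso_prod_GF isoS).
apply: sigma_iso_meadow isoS _; apply: prod_meadow => i; exact: field_meadow.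
Qed.
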